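(* Let $X$ be a reflexive Banach space over $\mathbb{K}$. The pair $(X,\mathbb{K})$ has property $\mathbf{L}_{p,o}$ if and only if the pair $(X^*,\mathbb{K})$ has property $\mathbf{L}_{o,p}$.
   Context: Banach spaces are over $\mathbb{K}$, which is $\mathbb{R}$ or $\mathbb{C}$. $S_X$ denotes the unit sphere of $X$, $X^*$ its topological dual, and $\mathcal{L}(X,Y)$ the space of bounded linear operators from $X$ to $Y$ with the operator norm (so $\mathcal{L}(X,\mathbb{K})=X^*$). A pair $(X,Y)$ of Banach spaces has property $\mathbf{L}_{p,o}$ if for every $\varepsilon>0$ and every $T\in\mathcal{L}(X,Y)$ with $\|T\|=1$ there is $\eta(\varepsilon,T)>0$ such that whenever $x\in S_X$ satisfies $\|T(x)\|>1-\eta(\varepsilon,T)$, there is $S\in\mathcal{L}(X,Y)$ with $\|S\|=1$, $\|S(x)\|=1$ and $\|S-T\|<\varepsilon$. A pair $(X,Y)$ of Banach spaces has property $\mathbf{L}_{o,p}$ if for every $\varepsilon>0$ and every $x\in S_X$ there is $\eta(\varepsilon,x)>0$ such that whenever $T\in\mathcal{L}(X,Y)$ with $\|T\|=1$ satisfies $\|T(x)\|>1-\eta(\varepsilon,x)$, there is $x_0\in S_X$ with $\|T(x_0)\|=1$ and $\|x_0-x\|<\varepsilon$. *)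

(* Defs.v *)
From Stdlib Require Import Reals Lra ClassicalEpsilon.
From Stdlib Require Import FunctionalExtensionality PropExtensionality ProofIrrelevance.
From Coquelicot Require Import Coquelicot.

Open Scope R_scope.

(* [scalars k] is the field K, which is R or C according to [k]; [scalar_space k]
   is K as a Banach space over itself. *)
Inductive scalar_kind := real_scalars | complex_scalars.

Definition scalars (k : scalar_kind) : AbsRing :=
  match k with
  | real_scalars => R_AbsRing
  | complex_scalars => C_AbsRing
  end.

Notation banach k := (CompleteNormedModule (scalars k)).

Definition scalar_space (k : scalar_kind) : banach k :=
  match k with
  | real_scalars => R_CompleteNormedModule
  | complex_scalars => C_CompleteNormedModule
  end.

Lemma scalars_mult_comm (k : scalar_kind) (a b : scalars k) : mult a b = mult b a.
Proof.
destruct k; simpl in a, b.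
- exact (Rmult_comm a b).
- exact (Cmult_comm a b).
Qed.

Lemma scalars_of_pos (k : scalar_kind) (r : R) : 0 < r ->
  exists c d : scalars k, mult d c = one /\ abs c = / r /\ abs d = r.
Proof.
intros Hr; assert (Hi := Rinv_0_lt_compat _ Hr).
destruct k; simpl.
- exists (/ r), r; repeat split.
  + apply Rinv_r; lra.
  + apply Rabs_pos_eq; lra.
  + apply Rabs_pos_eq; lra.
- exists (RtoC (/ r)), (RtoC r); repeat split.
  + change (Cmult (RtoC r) (RtoC (/ r)) = RtoC 1).
    rewrite <- RtoC_mult; f_equal; apply Rinv_r; lra.
  + change (Cmod (RtoC (/ r)) = / r); rewrite Cmod_R; apply Rabs_pos_eq; lra.
  + change (Cmod (RtoC r) = r); rewrite Cmod_R; apply Rabs_pos_eq; lra.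
Qed.

Lemma plus_plus_swap {G : AbelianMonoid} (a b c d : G) :
  plus (plus a b) (plus c d) = plus (plus a c) (plus b d).
Proof.
rewrite <- !plus_assoc; f_equal; rewrite !plus_assoc; f_equal; apply plus_comm.
Qed.

(* Coquelicot's [is_linear] includes boundedness. *)
Record bounded_operator (k : scalar_kind) (X Y : NormedModule (scalars k)) := Bounded_operator {
  op_fun :> X -> Y;
  op_linear : is_linear op_fun
}.

Arguments Bounded_operator {k X Y} _ _.
Arguments op_fun {k X Y} _ _.
Arguments op_linear {k X Y} _.

Section BoundedOperators.

Context {k : scalar_kind} {X Y : NormedModule (scalars k)}.

Notation L := (bounded_operator k X Y).

Lemma op_ext (S T : L) : (forall x, S x = T x) -> S = T.
Proof.
destruct S as [s Hs], T as [t Ht]; simpl; intros H.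
assert (E : s = t) by (apply functional_extensionality; exact H).
subst t; f_equal; apply proof_irrelevance.
Qed.

Lemma op_plus_linear (S T : L) : is_linear (fun x => plus (S x) (T x)).
Proof.
destruct (op_linear S) as [Sp Ss [MS [MS0 HS]]], (op_linear T) as [Tp Ts [MT [MT0 HT]]].
split.
- intros x y; rewrite Sp, Tp; apply plus_plus_swap.
- intros a x; rewrite Ss, Ts; symmetry; apply (@scal_distr_l _ Y).
- exists (MS + MT); split; [lra|]; intros x.
  eapply Rle_trans; [apply norm_triangle|].
  specialize (HS x); specialize (HT x); lra.
Qed.

Lemma op_zero_linear : is_linear (fun _ : X => zero : Y).
Proof.
split.
- intros x y; now rewrite plus_zero_l.
- intros a x; symmetry; apply (@scal_zero_r _ Y).
- exists 1; split; [lra|]; intros x; rewrite norm_zero, Rmult_1_l; apply norm_ge_0.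
Qed.

Lemma op_opp_linear (T : L) : is_linear (fun x => opp (T x)).
Proof.
destruct (op_linear T) as [Tp Ts [M [M0 HM]]]; split.
- intros x y; rewrite Tp; apply (@opp_plus Y).
- intros a x; rewrite Ts; symmetry; apply (@scal_opp_r _ Y).
- exists M; split; [exact M0|]; intros x; rewrite norm_opp; apply HM.
Qed.

Lemma op_scal_linear (a : scalars k) (T : L) : is_linear (fun x => scal a (T x)).
Proof.
destruct (op_linear T) as [Tp Ts [M [M0 HM]]]; split.
- intros x y; rewrite Tp; apply (@scal_distr_l _ Y).
- intros b x; rewrite Ts; etransitivity; [apply (@scal_assoc _ Y)|].
  rewrite (scalars_mult_comm k a b); symmetry; apply (@scal_assoc _ Y).
- assert (A := abs_ge_0 a); exists ((abs a + 1) * M); split.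
  + apply Rmult_lt_0_compat; lra.
  + intros x; eapply Rle_trans; [apply norm_scal|].
    rewrite Rmult_assoc; apply Rmult_le_compat; try lra; [apply norm_ge_0|apply HM].
Qed.

Definition op_plus (S T : L) : L := Bounded_operator _ (op_plus_linear S T).
Definition op_zero : L := Bounded_operator _ op_zero_linear.
Definition op_opp (T : L) : L := Bounded_operator _ (op_opp_linear T).
Definition op_scal (a : scalars k) (T : L) : L := Bounded_operator _ (op_scal_linear a T).

Lemma op_plus_comm (S T : L) : op_plus S T = op_plus T S.
Proof. apply op_ext; intros x; apply plus_comm. Qed.

Lemma op_plus_assoc (S T U : L) : op_plus S (op_plus T U) = op_plus (op_plus S T) U.
Proof. apply op_ext; intros x; apply plus_assoc. Qed.

Lemma op_plus_zero_r (T : L) : op_plus T op_zero = T.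
Proof. apply op_ext; intros x; apply plus_zero_r. Qed.

Lemma op_plus_opp_r (T : L) : op_plus T (op_opp T) = op_zero.
Proof. apply op_ext; intros x; apply (@plus_opp_r Y). Qed.

Definition op_AbelianMonoid_mixin :=
  AbelianMonoid.Mixin L op_plus op_zero op_plus_comm op_plus_assoc op_plus_zero_r.

Definition op_AbelianGroup_mixin :=
  AbelianGroup.Mixin (AbelianMonoid.Pack L op_AbelianMonoid_mixin L) op_opp op_plus_opp_r.

Definition op_AbelianGroup_class := AbelianGroup.Class L _ op_AbelianGroup_mixin.

Canonical op_AbelianMonoid := AbelianMonoid.Pack L op_AbelianMonoid_mixin L.
Canonical op_AbelianGroup := AbelianGroup.Pack L op_AbelianGroup_class L.

Lemma op_scal_assoc (a b : scalars k) (T : L) :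
  op_scal a (op_scal b T) = op_scal (mult a b) T.
Proof. apply op_ext; intros x; apply scal_assoc. Qed.

Lemma op_scal_one (T : L) : op_scal one T = T.
Proof. apply op_ext; intros x; apply (@scal_one _ Y). Qed.

Lemma op_scal_distr_l (a : scalars k) (S T : L) :
  op_scal a (plus S T) = plus (op_scal a S) (op_scal a T).
Proof. apply op_ext; intros x; apply (@scal_distr_l _ Y). Qed.

Lemma op_scal_distr_r (a b : scalars k) (T : L) :
  op_scal (plus a b) T = plus (op_scal a T) (op_scal b T).
Proof. apply op_ext; intros x; apply (@scal_distr_r _ Y). Qed.

Definition op_ModuleSpace_mixin :=
  ModuleSpace.Mixin (scalars k) op_AbelianGroup op_scal
    op_scal_assoc op_scal_one op_scal_distr_l op_scal_distr_r.

Definition op_ModuleSpace_class := ModuleSpace.Class _ L _ op_ModuleSpace_mixin.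

Canonical op_ModuleSpace := ModuleSpace.Pack (scalars k) L op_ModuleSpace_class L.

Definition op_norm (T : L) : R :=
  real (Lub_Rbar (fun r => exists x : X, norm x <= 1 /\ r = norm (T x))).

Lemma op_norm_lub (T : L) :
  is_lub_Rbar (fun r => exists x : X, norm x <= 1 /\ r = norm (T x)) (op_norm T).
Proof.
unfold op_norm.
set (E := fun r => exists x : X, norm x <= 1 /\ r = norm (T x)).
assert (H := Lub_Rbar_correct E); destruct (Lub_Rbar E) as [l| |]; simpl; auto.
- exfalso; destruct (linear_norm _ (op_linear T)) as [M [M0 HM]].
  destruct H as [_ H]; specialize (H (Finite M)); apply H.
  intros r [x [Hx ->]]; simpl; eapply Rle_trans; [apply HM|].
  rewrite <- (Rmult_1_r M) at 2; apply Rmult_le_compat_l; lra.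
- exfalso; destruct H as [H _]; apply (H (norm (T zero))).
  exists zero; split; [rewrite norm_zero; lra | reflexivity].
Qed.

Lemma op_norm_ub (T : L) (x : X) : norm x <= 1 -> norm (T x) <= op_norm T.
Proof.
intros Hx; destruct (op_norm_lub T) as [H _]; apply (H (norm (T x))).
now exists x.
Qed.

Lemma op_norm_le (T : L) (M : R) :
  (forall x, norm x <= 1 -> norm (T x) <= M) -> op_norm T <= M.
Proof.
intros H; destruct (op_norm_lub T) as [_ H']; apply (H' (Finite M)).
intros r [x [Hx ->]]; now apply H.
Qed.

Lemma op_norm_ge_0 (T : L) : 0 <= op_norm T.
Proof.
eapply Rle_trans; [apply (norm_ge_0 (T zero))|].
apply op_norm_ub; rewrite norm_zero; lra.
Qed.

Lemma op_norm_bound (T : L) (x : X) : norm (T x) <= op_norm T * norm x.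
Proof.
destruct (op_linear T) as [_ Ts [M [M0 HM]]].
destruct (Rle_lt_or_eq_dec _ _ (norm_ge_0 x)) as [Hx|Hx].
- destruct (scalars_of_pos k (norm x) Hx) as [c [d [Hdc [Hc Hd]]]].
  assert (E : x = scal d (scal c x)) by (rewrite scal_assoc, Hdc; symmetry; apply (@scal_one _ X)).
  rewrite E at 1; rewrite Ts.
  eapply Rle_trans; [apply norm_scal|]; rewrite Hd, Rmult_comm.
  apply Rmult_le_compat_r; [lra|]; apply op_norm_ub.
  eapply Rle_trans; [apply norm_scal|]; rewrite Hc, Rinv_l; lra.
- rewrite <- Hx; specialize (HM x); rewrite <- Hx in HM; lra.
Qed.

Lemma op_norm_triangle (S T : L) : op_norm (plus S T) <= op_norm S + op_norm T.
Proof.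
apply op_norm_le; intros x Hx; eapply Rle_trans; [apply (@norm_triangle _ Y)|].
apply Rplus_le_compat; now apply op_norm_ub.
Qed.

Lemma op_norm_scal (a : scalars k) (T : L) : op_norm (scal a T) <= abs a * op_norm T.
Proof.
apply op_norm_le; intros x Hx; eapply Rle_trans; [apply (@norm_scal _ Y)|].
apply Rmult_le_compat_l; [apply abs_ge_0 | now apply op_norm_ub].
Qed.

Lemma op_norm_eq_0 (T : L) : op_norm T = 0 -> T = zero.
Proof.
intros H; apply op_ext; intros x; apply (norm_eq_zero (T x)).
apply Rle_antisym; [|apply norm_ge_0].
eapply Rle_trans; [apply op_norm_bound|]; rewrite H; lra.
Qed.

Lemma op_norm_minus_sym (S T : L) : op_norm (minus S T) = op_norm (minus T S).
Proof.
apply Rle_antisym; apply op_norm_le; intros x Hx.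
- replace (minus S T x) with (opp (minus T S x)) by apply (@opp_minus Y).
  rewrite norm_opp; now apply op_norm_ub.
- replace (minus T S x) with (opp (minus S T x)) by apply (@opp_minus Y).
  rewrite norm_opp; now apply op_norm_ub.
Qed.

Definition op_ball (S : L) (e : R) (T : L) : Prop := op_norm (minus T S) < e.

Lemma op_ball_center (T : L) (e : posreal) : op_ball T e T.
Proof.
unfold op_ball; rewrite minus_eq_zero.
eapply Rle_lt_trans; [|apply cond_pos].
apply op_norm_le; intros x _; simpl; rewrite norm_zero; lra.
Qed.

Lemma op_ball_sym (S T : L) (e : R) : op_ball S e T -> op_ball T e S.
Proof. unfold op_ball; now rewrite op_norm_minus_sym. Qed.

Lemma op_ball_triangle (S T U : L) (e1 e2 : R) :
  op_ball S e1 T -> op_ball T e2 U -> op_ball S (e1 + e2) U.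
Proof.
unfold op_ball; intros H1 H2; rewrite (minus_trans T U S).
eapply Rle_lt_trans; [apply op_norm_triangle|]; lra.
Qed.

Definition op_UniformSpace_mixin :=
  UniformSpace.Mixin L zero op_ball op_ball_center op_ball_sym op_ball_triangle.

Canonical op_UniformSpace := UniformSpace.Pack L op_UniformSpace_mixin L.

Canonical op_NormedModuleAux :=
  NormedModuleAux.Pack (scalars k) L
    (NormedModuleAux.Class _ L op_ModuleSpace_class op_UniformSpace_mixin) L.

Lemma op_norm_ball (S T : L) (e : R) : op_norm (minus T S) < e -> ball S e T.
Proof. easy. Qed.

Lemma op_ball_norm (S T : L) (e : posreal) : ball S e T -> op_norm (minus T S) < 1 * e.
Proof. now rewrite Rmult_1_l. Qed.

Definition op_NormedModule_mixin :=
  NormedModule.Mixin (scalars k) op_NormedModuleAux op_norm 1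
    op_norm_triangle op_norm_scal op_norm_ball op_ball_norm op_norm_eq_0.

Definition op_NormedModule_class :=
  NormedModule.Class (scalars k) L _ op_NormedModule_mixin.

Canonical op_NormedModule := NormedModule.Pack (scalars k) L op_NormedModule_class L.

End BoundedOperators.

Lemma minus_plus_plus {G : AbelianGroup} (a b c d : G) :
  minus (plus a b) (plus c d) = plus (minus a c) (minus b d).
Proof.
transitivity (plus (plus a b) (plus (opp c) (opp d))).
- unfold minus; f_equal; apply opp_plus.
- apply plus_plus_swap.
Qed.

Lemma minus_minus_r {G : AbelianGroup} (u v : G) : minus u (minus u v) = v.
Proof.
transitivity (plus u (plus (opp u) v)).
- unfold minus; f_equal; etransitivity; [apply opp_plus|f_equal; apply opp_opp].
- etransitivity; [apply plus_assoc|].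
  etransitivity; [apply (f_equal (fun w => plus w v)), plus_opp_r | apply plus_zero_l].
Qed.

Lemma norm_minus_sym {K : AbsRing} {V : NormedModule K} (u v : V) :
  norm (minus u v) = norm (minus v u).
Proof. rewrite <- norm_opp; f_equal; apply opp_minus. Qed.

Lemma norm_minus_small {K : AbsRing} {V : NormedModule K} (u v : V) :
  (forall e, 0 < e -> norm (minus u v) <= e) -> u = v.
Proof.
intros H; assert (E : minus u v = zero).
{ apply norm_eq_zero, Rle_antisym; [|apply norm_ge_0].
  apply le_epsilon; intros e He; rewrite Rplus_0_l; now apply H. }
transitivity (plus (minus u v) v).
- symmetry; unfold minus; rewrite <- plus_assoc, plus_opp_l; apply plus_zero_r.
- rewrite E; apply plus_zero_l.
Qed.

Section BoundedOperatorsComplete.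

Context {k : scalar_kind} {X : NormedModule (scalars k)} {Y : banach k}.

Notation Yn := (CompleteNormedModule.NormedModule (scalars k) Y).
Notation L := (bounded_operator k X Y).

Section Completeness.

Variable F : (L -> Prop) -> Prop.
Context {FF : ProperFilter F}.
Hypothesis CF : cauchy F.

Definition op_image (x : X) : (Y -> Prop) -> Prop := filtermap (fun T : L => T x) F.

Definition op_lim_fun (x : X) : Yn := lim (op_image x).

Lemma op_cauchy_norm (e : R) : 0 < e -> exists T0 : L, F (fun T => op_norm (minus T T0) < e).
Proof. intros He; exact (CF (mkposreal e He)). Qed.

Lemma op_image_cauchy (x : X) : cauchy (op_image x).
Proof.
intros e.
assert (N := norm_ge_0 x).
assert (He : 0 < e / (norm x + 1)) by (apply Rdiv_lt_0_compat; [apply cond_pos|lra]).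
destruct (op_cauchy_norm _ He) as [T0 HT0].
exists (T0 x); unfold op_image, filtermap.
revert HT0; apply filter_imp; intros T HT.
apply (norm_compat1 (T0 x)); change (norm (minus T T0 x) < e).
eapply Rle_lt_trans; [apply op_norm_bound|].
apply Rle_lt_trans with (e / (norm x + 1) * norm x).
- apply Rmult_le_compat_r; lra.
- apply Rlt_le_trans with (e / (norm x + 1) * (norm x + 1)).
  + apply Rmult_lt_compat_l; lra.
  + right; field; lra.
Qed.

Lemma op_lim_pointwise (x : X) (e : R) :
  0 < e -> F (fun T => norm (minus (T x) (op_lim_fun x)) < e).
Proof.
intros He.
assert (NF := @norm_factor_gt_0 (scalars k) Y).
assert (He' : 0 < e / @norm_factor (scalars k) Y) by (apply Rdiv_lt_0_compat; lra).
assert (PF : ProperFilter (op_image x)) by apply filtermap_proper_filter, FF.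
assert (H := complete_cauchy (op_image x) PF (op_image_cauchy x) (mkposreal _ He')).
revert H; unfold op_image, filtermap; apply filter_imp; intros T HT.
apply (@norm_compat2 _ Y) in HT; simpl in HT.
replace e with (@norm_factor (scalars k) Y * (e / @norm_factor (scalars k) Y)) by (field; lra).
exact HT.
Qed.

Lemma op_lim_close (e : R) : 0 < e ->
  exists T0 : L, F (fun T => op_norm (minus T T0) < e) /\
    forall (T : L) (x : X), op_norm (minus T T0) < e ->
      norm (minus (T x) (op_lim_fun x)) <= 2 * e * norm x.
Proof.
intros He; destruct (op_cauchy_norm e He) as [T0 HT0].
exists T0; split; [exact HT0|]; intros T x HT.
apply le_epsilon; intros d Hd.
destruct (filter_ex _ (filter_and _ _ HT0 (op_lim_pointwise x d Hd))) as [U [HU1 HU2]].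
rewrite (minus_trans (U x)).
eapply Rle_trans; [apply norm_triangle|].
apply Rplus_le_compat; [|lra].
change (norm (minus T U x) <= 2 * e * norm x).
eapply Rle_trans; [apply op_norm_bound|].
apply Rmult_le_compat_r; [apply norm_ge_0|].
rewrite (minus_trans T0).
eapply Rle_trans; [apply op_norm_triangle|].
rewrite (op_norm_minus_sym T0 U); lra.
Qed.

Lemma op_lim_linear : is_linear op_lim_fun.
Proof.
split.
- intros x y; apply norm_minus_small; intros e He.
  assert (He3 : 0 < e / 3) by lra.
  destruct (filter_ex _ (filter_and _ _ (op_lim_pointwise (plus x y) _ He3)
    (filter_and _ _ (op_lim_pointwise x _ He3) (op_lim_pointwise y _ He3))))
    as [T [H1 [H2 H3]]].
  apply Rle_trans with (norm (minus (op_lim_fun (plus x y)) (T (plus x y))) +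
    norm (minus (T (plus x y)) (plus (op_lim_fun x) (op_lim_fun y)))).
  { rewrite (minus_trans (T (plus x y))); apply norm_triangle. }
  replace e with (e / 3 + (e / 3 + e / 3)) by lra; apply Rplus_le_compat.
  { rewrite norm_minus_sym; apply Rlt_le, H1. }
  rewrite (linear_plus _ (op_linear T)), (@minus_plus_plus Yn).
  eapply Rle_trans; [apply (@norm_triangle _ Y)|].
  apply Rplus_le_compat; apply Rlt_le; assumption.
- intros a x; apply norm_minus_small; intros e He.
  assert (A := abs_ge_0 a).
  assert (He2 : 0 < e / 2) by lra.
  assert (He3 : 0 < e / 2 / (abs a + 1)) by (apply Rdiv_lt_0_compat; lra).
  destruct (filter_ex _ (filter_and _ _ (op_lim_pointwise (scal a x) _ He2)
    (op_lim_pointwise x _ He3))) as [T [H1 H2]].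
  apply Rle_trans with (norm (minus (op_lim_fun (scal a x)) (T (scal a x))) +
    norm (minus (T (scal a x)) (scal a (op_lim_fun x)))).
  { rewrite (minus_trans (T (scal a x))); apply norm_triangle. }
  replace e with (e / 2 + e / 2) by lra; apply Rplus_le_compat.
  { rewrite norm_minus_sym; apply Rlt_le, H1. }
  rewrite (linear_scal _ (op_linear T)), <- (@scal_minus_distr_l _ Yn).
  eapply Rle_trans; [apply (@norm_scal _ Y)|].
  apply Rle_trans with ((abs a + 1) * (e / 2 / (abs a + 1))).
  + apply Rmult_le_compat; [lra|apply norm_ge_0|lra|apply Rlt_le, H2].
  + right; field; lra.
- destruct (op_lim_close 1 Rlt_0_1) as [T0 [HF H]].
  destruct (filter_ex _ HF) as [T HT].
  exists (op_norm T + 2); split; [assert (N := op_norm_ge_0 T); lra|].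
  intros x; specialize (H T x HT).
  replace (op_lim_fun x) with (minus (T x) (minus (T x) (op_lim_fun x))).
  + eapply Rle_trans; [apply norm_triangle|]; rewrite norm_opp.
    assert (B := op_norm_bound T x); lra.
  + apply (@minus_minus_r Y).
Qed.

Lemma op_cauchy_cvg : exists T : L, forall e : posreal, F (ball T e).
Proof.
exists (Bounded_operator _ op_lim_linear); intros e.
assert (He := cond_pos e); assert (He3 : 0 < e / 3) by lra.
destruct (op_lim_close _ He3) as [T0 [HF H]].
revert HF; apply filter_imp; intros T HT; apply op_norm_ball.
apply Rle_lt_trans with (2 * (e / 3)); [|lra].
apply op_norm_le; intros x Hx.
eapply Rle_trans; [exact (H T x HT)|].
rewrite <- (Rmult_1_r (2 * (e / 3))) at 2; apply Rmult_le_compat_l; lra.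
Qed.

End Completeness.

Definition op_lim (F : (L -> Prop) -> Prop) : L :=
  epsilon (inhabits (op_zero : L)) (fun T : L => forall e : posreal, F (ball T e)).

Lemma op_complete (F : (L -> Prop) -> Prop) :
  ProperFilter F -> cauchy F -> forall e : posreal, F (ball (op_lim F) e).
Proof.
intros FF CF; exact (epsilon_spec (inhabits (op_zero : L)) _ (@op_cauchy_cvg F FF CF)).
Qed.

Lemma op_close_lim (F1 F2 : (L -> Prop) -> Prop) :
  filter_le F1 F2 -> filter_le F2 F1 -> close (op_lim F1) (op_lim F2).
Proof.
intros H12 H21; assert (E : F1 = F2).
{ apply functional_extensionality; intros P; apply propositional_extensionality; split.
  - apply H21.
  - apply H12. }
rewrite E; apply close_refl.
Qed.

Definition op_CompleteSpace_mixin :=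
  CompleteSpace.Mixin op_UniformSpace op_lim op_complete op_close_lim.

Canonical op_CompleteSpace :=
  CompleteSpace.Pack L (CompleteSpace.Class L _ op_CompleteSpace_mixin) L.

Canonical op_CompleteNormedModule :=
  CompleteNormedModule.Pack (scalars k) L
    (CompleteNormedModule.Class _ L op_NormedModule_class op_CompleteSpace_mixin) L.

End BoundedOperatorsComplete.

Definition operators {k : scalar_kind} (X Y : banach k) : banach k :=
  @op_CompleteNormedModule k X Y.

Definition dual {k : scalar_kind} (X : banach k) : banach k :=
  operators X (scalar_space k).

Section Bidual.

Context {k : scalar_kind} {X : banach k}.

Lemma eval_linear (x : X) : is_linear (fun f : dual X => (f x : scalar_space k)).
Proof.
split.
- easy.
- easy.
- exists (norm x + 1); assert (N := norm_ge_0 x); split; [lra|]; intros f.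
  eapply Rle_trans; [apply (op_norm_bound f)|].
  rewrite Rmult_comm; apply Rmult_le_compat_r; [apply op_norm_ge_0|lra].
Qed.

Definition canonical_embedding (x : X) : dual (dual X) :=
  Bounded_operator (fun f : dual X => (f x : scalar_space k)) (eval_linear x).

End Bidual.

Definition reflexive {k : scalar_kind} (X : banach k) : Prop :=
  forall phi : dual (dual X), exists x : X, canonical_embedding x = phi.

Definition property_L_po {k : scalar_kind} (X Y : banach k) : Prop :=
  forall (eps : R) (T : operators X Y), 0 < eps -> norm T = 1 ->
    exists eta : R, 0 < eta /\
      forall x : X, norm x = 1 -> norm (T x) > 1 - eta ->
        exists S : operators X Y,
          norm S = 1 /\ norm (S x) = 1 /\ norm (minus S T) < eps.

Definition property_L_op {k : scalar_kind} (X Y : banach k) : Prop :=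
  forall (eps : R) (x : X), 0 < eps -> norm x = 1 ->
    exists eta : R, 0 < eta /\
      forall T : operators X Y, norm T = 1 -> norm (T x) > 1 - eta ->
        exists x0 : X,
          norm x0 = 1 /\ norm (T x0) = 1 /\ norm (minus x0 x) < eps.

(* Main.v *)
Require Import Defs.
From Stdlib Require Import Reals Lra.
From Stdlib Require Import FunctionalExtensionality ProofIrrelevance.
From Coquelicot Require Import Coquelicot.
From mathcomp Require boolp classical_sets.

(** The two properties are the same statement read through the canonical
    embedding [J : X -> X**].  For a functional [f] and a point [x] one has
    [(J x) f = f x], so in [L_po] for [X] the functional is fixed and the point
    [x] varies, while in [L_op] for [X*] the point [f] is fixed and the
    functional [J x] varies; the perturbed functional of [L_po] is the perturbed
    point of [L_op], with the same [eta].  What makes this translation exact is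
    that [J] maps the unit sphere of [X] onto that of [X**]: it is onto by
    reflexivity, and isometric by the Hahn-Banach theorem
    ([norm_canonical_embedding]).

    The consequence of Hahn-Banach that is used says that every [x] is normed by
    a functional of norm at most [1] ([norming_functional]).  It is proved
    without extending partially defined functionals.  By Zorn's lemma there is a
    minimal sublinear function below any given one, and a minimal sublinear
    function [q] is linear: replacing [q] by
    [x |-> inf_(t >= 0) (q (x + t y) - t q y)] cannot make it smaller, which
    forces [q] to be additive.  The same modification, applied to the norm with
    [y := x0] before Zorn's lemma, ensures that the linear function obtained
    takes the value [norm x0] at [x0].  For complex scalars, the real functional
    [q] found in this way is the real part of [x |-> q x - i q (i x)]. *)

(** * Sublinear functions on a real vector space *)

Section Sublinear.

Context {V : ModuleSpace R_Ring}.

(** [plus_opp_r] and [plus_opp_l], phrased with the additive monoid that is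
    inferred for [V], so that they rewrite. *)
Lemma plus_opp_self (x : V) : plus x (opp x) = zero.
Proof. apply (@plus_opp_r V). Qed.

Lemma opp_plus_self (x : V) : plus (opp x : V) x = zero.
Proof. apply (@plus_opp_l V). Qed.

Definition sublinear (q : V -> R) : Prop :=
  (forall x y, q (plus x y) <= q x + q y) /\
  (forall r x, 0 < r -> q (scal r x) <= r * q x).

Definition real_linear (q : V -> R) : Prop :=
  (forall x y, q (plus x y) = q x + q y) /\
  (forall r x, q (scal r x) = r * q x).

Definition fun_le (q p : V -> R) : Prop := forall x, q x <= p x.

Lemma sublinear_zero (q : V -> R) : sublinear q -> q zero = 0.
Proof.
intros [_ Hs].
assert (H2 := Hs 2 zero ltac:(lra)); assert (H1 := Hs (/ 2) zero ltac:(lra)).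
rewrite scal_zero_r in H1, H2; lra.
Qed.

Lemma sublinear_opp (q : V -> R) (x : V) : sublinear q -> - q (opp x) <= q x.
Proof.
intros Hq; assert (H := proj1 Hq x (opp x)).
rewrite plus_opp_self, (sublinear_zero q Hq) in H; lra.
Qed.

Lemma sublinear_scal (q : V -> R) (r : R) (x : V) :
  sublinear q -> 0 <= r -> q (scal r x) = r * q x.
Proof.
intros Hq [Hr|<-].
- apply Rle_antisym; [now apply Hq|].
  assert (H := proj2 Hq (/ r) (scal r x) (Rinv_0_lt_compat _ Hr)).
  rewrite scal_assoc in H; change (mult (/ r) r) with (/ r * r) in H.
  rewrite Rinv_l in H by lra; change 1 with (@one R_Ring) in H.
  rewrite scal_one in H.
  apply (Rmult_le_compat_l r) in H; [|lra].
  rewrite <- Rmult_assoc, Rinv_r in H by lra; lra.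
- change 0 with (@zero R_Ring) at 1; rewrite scal_zero_l, (sublinear_zero q Hq); lra.
Qed.

Lemma real_linear_opp (q : V -> R) (x : V) : real_linear q -> q (opp x) = - q x.
Proof. intros [_ Hs]; rewrite <- (scal_opp_one x), Hs; change (opp one) with (-1); lra. Qed.

(** Additivity is all that separates a sublinear function from a linear one,
    since it extends homogeneity to negative scalars. *)
Lemma sublinear_additive_linear (q : V -> R) :
  sublinear q -> (forall x y, q x + q y <= q (plus x y)) -> real_linear q.
Proof.
intros Hq Ha.
assert (Hp : forall x y, q (plus x y) = q x + q y).
{ intros x y; apply Rle_antisym; [apply Hq|apply Ha]. }
assert (Ho : forall x, q (opp x) = - q x).
{ intros x; assert (H := Hp x (opp x)).
  rewrite plus_opp_self, (sublinear_zero q Hq) in H; lra. }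
split; [exact Hp|]; intros r x.
destruct (Rle_lt_dec 0 r) as [Hr|Hr]; [now apply sublinear_scal|].
assert (E : scal r x = opp (scal (- r) x)).
{ rewrite <- (@scal_opp_l R_Ring V); f_equal; symmetry; apply Ropp_involutive. }
rewrite E, Ho, sublinear_scal; try assumption; lra.
Qed.

Definition pointwise_inf {I : Type} (g : I -> V -> R) (x : V) : R :=
  real (Glb_Rbar (fun r => exists i, r = g i x)).

Section PointwiseInf.

Context {I : Type} (i0 : I) (g : I -> V -> R) (b : V -> R).
Hypothesis Hb : forall i x, b x <= g i x.

Lemma pointwise_inf_is_glb (x : V) :
  is_glb_Rbar (fun r => exists i, r = g i x) (pointwise_inf g x).
Proof.
unfold pointwise_inf; set (E := fun r => exists i, r = g i x).
assert (H := Glb_Rbar_correct E); destruct (Glb_Rbar E) as [l| |]; simpl; auto; exfalso.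
- apply (proj1 H (g i0 x)); now exists i0.
- apply (proj2 H (Finite (b x))); intros r [i ->]; apply Hb.
Qed.

Lemma pointwise_inf_le (i : I) (x : V) : pointwise_inf g x <= g i x.
Proof. apply (proj1 (pointwise_inf_is_glb x) (g i x)); now exists i. Qed.

Lemma pointwise_inf_glb (c : R) (x : V) :
  (forall i, c <= g i x) -> c <= pointwise_inf g x.
Proof.
intros H; apply (proj2 (pointwise_inf_is_glb x) (Finite c)).
intros r [i ->]; apply H.
Qed.

(** The members of the family need not be sublinear: subadditivity and
    homogeneity are allowed to change the index.  This covers both infima taken
    below, over a chain and over the parameter of [shift]. *)
Lemma pointwise_inf_sublinear :
  (forall i j x y, exists l, g l (plus x y) <= g i x + g j y) ->
  (forall i r x, 0 < r -> exists j, g j (scal r x) <= r * g i x) ->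
  sublinear (pointwise_inf g).
Proof.
intros Hp Hs; split.
- intros x y.
  assert (H : forall i j, pointwise_inf g (plus x y) <= g i x + g j y).
  { intros i j; destruct (Hp i j x y) as [l Hl].
    eapply Rle_trans; [apply (pointwise_inf_le l)|exact Hl]. }
  assert (H' : pointwise_inf g (plus x y) - pointwise_inf g y <= pointwise_inf g x).
  { apply pointwise_inf_glb; intros i.
    assert (pointwise_inf g (plus x y) - g i x <= pointwise_inf g y); [|lra].
    apply pointwise_inf_glb; intros j; specialize (H i j); lra. }
  lra.
- intros r x Hr.
  assert (H : / r * pointwise_inf g (scal r x) <= pointwise_inf g x).
  { apply pointwise_inf_glb; intros i; destruct (Hs i r x Hr) as [j Hj].
    apply Rmult_le_reg_l with r; [exact Hr|].
    rewrite <- Rmult_assoc, Rinv_r, Rmult_1_l by lra.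
    eapply Rle_trans; [apply (pointwise_inf_le j)|exact Hj]. }
  apply (Rmult_le_compat_l r) in H; [|lra].
  rewrite <- Rmult_assoc, Rinv_r in H by lra; lra.
Qed.

End PointwiseInf.

(** The largest sublinear function below [q] whose value at [opp y] is at most
    [- q y]; it measures how far [q] is from being additive in the direction
    [y]. *)
Definition shift (q : V -> R) (y : V) : V -> R :=
  pointwise_inf (fun (t : nonnegreal) x => q (plus x (scal (t : R) y)) - t * q y).

Lemma shift_lower_bound (q : V -> R) (y : V) (t : nonnegreal) (x : V) :
  sublinear q -> - q (opp x) <= q (plus x (scal (t : R) y)) - t * q y.
Proof.
intros Hq; assert (H := proj1 Hq (opp x) (plus x (scal (t : R) y))).
rewrite plus_assoc, opp_plus_self, plus_zero_l in H.
rewrite sublinear_scal in H; [lra|exact Hq|apply cond_nonneg].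
Qed.

Lemma shift_le (q : V -> R) (y : V) (t : R) (x : V) : sublinear q -> 0 <= t ->
  shift q y x <= q (plus x (scal t y)) - t * q y.
Proof.
intros Hq Ht.
apply (pointwise_inf_le (mknonnegreal t Ht) _ (fun x => - q (opp x))
  (fun s z => shift_lower_bound q y s z Hq) (mknonnegreal t Ht)).
Qed.

Lemma shift_le_self (q : V -> R) (y : V) : sublinear q -> fun_le (shift q y) q.
Proof.
intros Hq x; assert (H := shift_le q y 0 x Hq (Rle_refl 0)).
change 0 with (@zero R_Ring) in H at 1.
rewrite scal_zero_l, plus_zero_r in H; lra.
Qed.

Lemma shift_sublinear (q : V -> R) (y : V) : sublinear q -> sublinear (shift q y).
Proof.
intros Hq.
apply (pointwise_inf_sublinear (mknonnegreal 0 (Rle_refl 0)) _ (fun x => - q (opp x))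
  (fun s z => shift_lower_bound q y s z Hq)).
- intros [s Hs] [t Ht] x z; exists (mknonnegreal (s + t) (Rplus_le_le_0_compat _ _ Hs Ht)).
  simpl; change (s + t) with (@plus R_Ring s t) at 1.
  rewrite scal_distr_r, plus_plus_swap.
  assert (H := proj1 Hq (plus x (scal s y)) (plus z (scal t y))); lra.
- intros [t Ht] r x Hr.
  exists (mknonnegreal (r * t) (Rmult_le_pos _ _ (Rlt_le _ _ Hr) Ht)).
  simpl; change (r * t) with (@mult R_Ring r t) at 1.
  rewrite <- scal_assoc, <- scal_distr_l.
  assert (H := proj2 Hq r (plus x (scal t y)) Hr); lra.
Qed.

(** If [q] is minimal then [shift q y = q], and the term [t = 1] of the infimum
    gives [q x <= q (x + y) - q y]. *)
Lemma minimal_sublinear_linear (q : V -> R) : sublinear q ->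
  (forall q', sublinear q' -> fun_le q' q -> q' = q) -> real_linear q.
Proof.
intros Hq Hmin; apply sublinear_additive_linear; [exact Hq|]; intros x y.
assert (H := shift_le q y 1 x Hq Rle_0_1).
rewrite (Hmin _ (shift_sublinear q y Hq) (shift_le_self q y Hq)) in H.
change 1 with (@one R_Ring) in H at 1; rewrite scal_one in H; lra.
Qed.

(** Zorn's lemma applies because every sublinear [g <= p] satisfies
    [- p (- x) <= g x], so that a chain has a finite pointwise infimum; the two
    indices met in a subadditivity estimate are comparable, and the smaller
    member serves for both. *)
Lemma minimal_sublinear_minorant (p : V -> R) : sublinear p ->
  exists q, sublinear q /\ fun_le q p /\
    (forall q', sublinear q' -> fun_le q' q -> q' = q).
Proof.
intros Hp.
pose (T := {q : V -> R | sublinear q /\ fun_le q p}).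
(* The order is reversed: maximal elements for [le] are minimal functions. *)
pose (le := fun s t : T => boolp.asbool (fun_le (proj1_sig t) (proj1_sig s))).
assert (T_ext : forall s t : T, proj1_sig s = proj1_sig t -> s = t).
{ intros [s Hs] [t Ht]; simpl; intros ->; f_equal; apply proof_irrelevance. }
assert (Hmax : exists t : T, forall s, is_true (le t s) -> s = t).
{ apply classical_sets.Zorn.
  - intros s; apply boolp.asboolT; intros x; apply Rle_refl.
  - intros s t u Hst Htu; apply boolp.asboolT; intros x.
    apply boolp.asboolW in Hst, Htu; eapply Rle_trans; [apply Htu|apply Hst].
  - intros s t Hst Hts; apply boolp.asboolW in Hst, Hts; apply T_ext.
    apply functional_extensionality; intros x; apply Rle_antisym; [apply Hts|apply Hst].
  - intros A HA.
    destruct (boolp.EM (exists s, A s)) as [[s0 Hs0]|HA0].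
    + pose (g := fun (s : {s : T | A s}) => proj1_sig (proj1_sig s)).
      assert (Hg : forall s, sublinear (g s)) by (intros s; apply (proj2_sig (proj1_sig s))).
      assert (Hgp : forall s, fun_le (g s) p) by (intros s; apply (proj2_sig (proj1_sig s))).
      assert (Hb : forall s x, - p (opp x) <= g s x).
      { intros s x; assert (H1 := sublinear_opp _ x (Hg s)).
        assert (H2 := Hgp s (opp x)); lra. }
      pose (i0 := exist (fun s => A s) s0 Hs0).
      assert (Hinf : sublinear (pointwise_inf g)).
      { apply (pointwise_inf_sublinear i0 g _ Hb).
        - intros i j x y.
          destruct (HA _ _ (proj2_sig i) (proj2_sig j)) as [H|H];
            apply boolp.asboolW in H.
          + exists j; eapply Rle_trans; [apply Hg|].
            apply Rplus_le_compat_r, H.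
          + exists i; eapply Rle_trans; [apply Hg|].
            apply Rplus_le_compat_l, H.
        - intros i r x Hr; exists i; now apply Hg. }
      assert (Hinfp : fun_le (pointwise_inf g) p).
      { intros x; eapply Rle_trans; [apply (pointwise_inf_le i0 g _ Hb i0)|apply Hgp]. }
      exists (exist _ (pointwise_inf g) (conj Hinf Hinfp)).
      intros s Hs; apply boolp.asboolT; intros x; simpl.
      apply (pointwise_inf_le i0 g _ Hb (exist (fun s => A s) s Hs)).
    + exists (exist _ p (conj Hp (fun x => Rle_refl (p x)))).
      intros s Hs; destruct HA0; now exists s. }
destruct Hmax as [[q [Hq Hqp]] Hmax]; exists q; repeat split; try assumption; try apply Hq.
intros q' Hq' Hle.
assert (Hq'p : fun_le q' p) by (intros x; eapply Rle_trans; [apply Hle|apply Hqp]).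
exact (f_equal (@proj1_sig _ _)
  (Hmax (exist _ q' (conj Hq' Hq'p)) (boolp.asboolT Hle))).
Qed.

(** The linear function is found below [shift p x0]; its value at [opp x0] is
    then at most [- p x0], which pins the value at [x0]. *)
Lemma hahn_banach_support (p : V -> R) (x0 : V) : sublinear p ->
  exists q, real_linear q /\ fun_le q p /\ q x0 = p x0.
Proof.
intros Hp.
destruct (minimal_sublinear_minorant _ (shift_sublinear p x0 Hp)) as [q [Hq [Hle Hmin]]].
assert (Hlin := minimal_sublinear_linear q Hq Hmin).
assert (Hqp : fun_le q p).
{ intros x; eapply Rle_trans; [apply Hle|now apply shift_le_self]. }
exists q; split; [exact Hlin|split; [exact Hqp|]].
apply Rle_antisym; [apply Hqp|].
assert (H : q (opp x0) <= - p x0).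
{ eapply Rle_trans; [apply Hle|].
  eapply Rle_trans; [apply (shift_le p x0 1 _ Hp Rle_0_1)|].
  change 1 with (@one R_Ring) at 1.
  rewrite scal_one, opp_plus_self, (sublinear_zero p Hp); lra. }
rewrite (real_linear_opp q x0 Hlin) in H; lra.
Qed.

End Sublinear.

(** * Norming functionals over the real and the complex field *)

Lemma norm_sublinear (X : NormedModule R_AbsRing) :
  sublinear (norm : X -> R).
Proof.
split.
- apply (@norm_triangle _ X).
- intros r x Hr; eapply Rle_trans; [apply (@norm_scal _ X r x)|].
  change (abs r) with (Rabs r); rewrite Rabs_pos_eq; lra.
Qed.

Lemma real_norming_functional (X : banach real_scalars) (x0 : X) :
  exists f : dual X, norm f <= 1 /\ norm x0 <= norm (f x0).
Proof.
destruct (hahn_banach_support _ x0 (norm_sublinear X)) as [q [Hq [Hle H0]]].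
assert (Hb : forall x : X, Rabs (q x) <= norm x).
{ intros x; apply Rabs_le; split; [|apply Hle].
  assert (H : q (opp x) <= norm (opp x)) by apply Hle.
  assert (E : q (opp x) = - q x) by apply (real_linear_opp q x Hq).
  rewrite E, (@norm_opp _ X) in H; lra. }
assert (Hl : @is_linear R_AbsRing X (scalar_space real_scalars) q).
{ split; [apply Hq|apply Hq|].
  exists 1; split; [lra|]; intros x; rewrite Rmult_1_l; apply Hb. }
exists (@Bounded_operator real_scalars X (scalar_space real_scalars) q Hl); split.
- apply (@op_norm_le real_scalars); intros x Hx; eapply Rle_trans; [apply Hb|exact Hx].
- eapply Rle_trans; [apply Req_le; symmetry; exact H0|apply Rle_abs].
Qed.

Section RestrictScalars.

Context (X : NormedModule C_AbsRing).

Definition real_scal (r : R) (x : X) : X := scal (RtoC r : C_AbsRing) x.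

Lemma real_scal_assoc (r s : R) (x : X) :
  real_scal r (real_scal s x) = real_scal (mult r s) x.
Proof.
unfold real_scal; rewrite scal_assoc; f_equal; symmetry; apply RtoC_mult.
Qed.

Lemma real_scal_one (x : X) : real_scal one x = x.
Proof. apply (scal_one x). Qed.

Lemma real_scal_distr_l (r : R) (x y : X) :
  real_scal r (plus x y) = plus (real_scal r x) (real_scal r y).
Proof. apply (@scal_distr_l _ X). Qed.

Lemma real_scal_distr_r (r s : R) (x : X) :
  real_scal (plus r s) x = plus (real_scal r x) (real_scal s x).
Proof.
unfold real_scal; rewrite <- (@scal_distr_r _ X); f_equal; apply RtoC_plus.
Qed.

Definition restrict_scalars : ModuleSpace R_Ring :=
  ModuleSpace.Pack R_Ring X
    (ModuleSpace.Class R_Ring X _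
      (ModuleSpace.Mixin R_Ring X real_scal
        real_scal_assoc real_scal_one real_scal_distr_l real_scal_distr_r)) X.

Lemma norm_sublinear_restrict_scalars :
  sublinear (norm : restrict_scalars -> R).
Proof.
split.
- exact (@norm_triangle _ X).
- intros r x Hr; eapply Rle_trans; [apply (@norm_scal _ X (RtoC r) x)|].
  change (Cmod (RtoC r) * @norm _ X x <= r * @norm _ X x).
  rewrite Cmod_R, Rabs_pos_eq; lra.
Qed.

End RestrictScalars.

Lemma Cmod_rotation (z : C) : exists c : C, Cmod c <= 1 /\ (c * z)%C = RtoC (Cmod z).
Proof.
destruct (Req_dec (Cmod z) 0) as [Hz|Hz].
- exists 0%C; split; [rewrite Cmod_0; lra|rewrite Hz; ring].
- exists (Cconj z * RtoC (/ Cmod z))%C; split.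
  + rewrite Cmod_mult, Cmod_conj, Cmod_R, Rabs_pos_eq; [right; field; exact Hz|].
    apply Rlt_le, Rinv_0_lt_compat; assert (H := Cmod_ge_0 z); lra.
  + replace (Cconj z * RtoC (/ Cmod z) * z)%C with (z * Cconj z * RtoC (/ Cmod z))%C by ring.
    rewrite <- Cmod2_conj, <- RtoC_mult; f_equal; field; exact Hz.
Qed.

Section Complexification.

Context {X : NormedModule C_AbsRing} (q : restrict_scalars X -> R).
Hypothesis Hq : real_linear q.
Hypothesis Hle : forall x : X, q x <= norm x.

(** The only complex linear functional with real part [q]. *)
Definition complexify (x : X) : C := (q x, - q (scal (Ci : C_AbsRing) x)).

Lemma complexify_plus (x y : X) :
  complexify (plus x y) = (complexify x + complexify y)%C.
Proof.
unfold complexify, Cplus; simpl; f_equal; [apply Hq|].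
rewrite (@scal_distr_l _ X).
transitivity (- (q (scal (Ci : C_AbsRing) x) + q (scal (Ci : C_AbsRing) y))); [|ring].
f_equal; apply Hq.
Qed.

Lemma complexify_scal (a : C) (x : X) :
  complexify (scal (a : C_AbsRing) x) = (a * complexify x)%C.
Proof.
destruct a as [r s].
assert (E : forall (a : C_AbsRing) u v, a = (RtoC u + RtoC v * Ci)%C ->
  q (scal a x) = u * q x + v * q (scal (Ci : C_AbsRing) x)).
{ intros a u v ->.
  transitivity (q (plus (scal (RtoC u : C_AbsRing) x)
    (scal (RtoC v : C_AbsRing) (scal (Ci : C_AbsRing) x)))).
  - f_equal; rewrite (@scal_assoc _ X); apply (@scal_distr_r _ X).
  - destruct Hq as [Hp Hs].
    etransitivity; [apply Hp|]; f_equal; [exact (Hs u x)|exact (Hs v (scal (Ci : C_AbsRing) x))]. }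
unfold complexify, Cmult; simpl; f_equal.
- rewrite (E (r, s) r s); [ring|].
  apply injective_projections; simpl; ring.
- rewrite (@scal_assoc _ X), (E _ (- s) r); [ring|].
  change (Ci * (r, s) = RtoC (- s) + RtoC r * Ci)%C.
  apply injective_projections; simpl; ring.
Qed.

(** At a point where the functional is real and nonnegative its modulus is the
    value of [q]; a rotation of [x] leads to such a point. *)
Lemma Cmod_complexify_le (x : X) : Cmod (complexify x) <= norm x.
Proof.
destruct (Cmod_rotation (complexify x)) as [c [Hc Hcx]].
rewrite <- complexify_scal in Hcx; apply (f_equal fst) in Hcx; simpl in Hcx.
rewrite <- Hcx; eapply Rle_trans; [apply Hle|].
eapply Rle_trans; [apply (@norm_scal _ X)|].
change (Cmod c * @norm _ X x <= @norm _ X x).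
assert (N := norm_ge_0 x); rewrite <- (Rmult_1_l (norm x)) at 2.
now apply Rmult_le_compat_r.
Qed.

Lemma complexify_linear :
  @is_linear C_AbsRing X (scalar_space complex_scalars) complexify.
Proof.
split; [apply complexify_plus|apply complexify_scal|].
exists 1; split; [lra|]; intros x; rewrite Rmult_1_l; apply Cmod_complexify_le.
Qed.

End Complexification.

Lemma complex_norming_functional (X : banach complex_scalars) (x0 : X) :
  exists f : dual X, norm f <= 1 /\ norm x0 <= norm (f x0).
Proof.
destruct (@hahn_banach_support (restrict_scalars X) _ x0 (norm_sublinear_restrict_scalars X))
  as [q [Hq [Hle H0]]].
exists (@Bounded_operator complex_scalars X (scalar_space complex_scalars) _
  (complexify_linear q Hq Hle)); split.
- apply (@op_norm_le complex_scalars); intros x Hx.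
  eapply Rle_trans; [exact (Cmod_complexify_le q Hq Hle x)|exact Hx].
- eapply Rle_trans; [apply Req_le; symmetry; exact H0|].
  change (q x0 <= Cmod (complexify q x0)).
  eapply Rle_trans; [apply Rle_abs|apply (re_le_Cmod (complexify q x0))].
Qed.

Lemma norming_functional (k : scalar_kind) (X : banach k) (x0 : X) :
  exists f : dual X, norm f <= 1 /\ norm x0 <= norm (f x0).
Proof.
destruct k; [apply real_norming_functional|apply complex_norming_functional].
Qed.

(** * The canonical embedding and the equivalence *)

Lemma norm_canonical_embedding (k : scalar_kind) (X : banach k) (x : X) :
  norm (canonical_embedding x) = norm x.
Proof.
apply Rle_antisym.
- apply op_norm_le; intros f Hf.
  change (norm ((f : dual X) x) <= norm x).
  assert (N := norm_ge_0 x).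
  eapply Rle_trans; [apply (op_norm_bound f)|].
  rewrite <- (Rmult_1_l (norm x)) at 2; now apply Rmult_le_compat_r.
- destruct (norming_functional k X x) as [f [Hf Hx]].
  eapply Rle_trans; [exact Hx|].
  exact (op_norm_ub (canonical_embedding x) f Hf).
Qed.

Theorem proposition2p4 (k : scalar_kind) (X : banach k) (hX : reflexive X) :
  property_L_po X (scalar_space k) <-> property_L_op (dual X) (scalar_space k).
Proof.
split.
- intros Hpo eps f Heps Hf.
  destruct (Hpo eps f Heps Hf) as [eta [Heta H]].
  exists eta; split; [exact Heta|]; intros phi Hphi Hphif.
  destruct (hX phi) as [x <-].
  apply H; [|exact Hphif].
  rewrite <- norm_canonical_embedding; exact Hphi.
- intros Hop eps f Heps Hf.
  destruct (Hop eps f Heps Hf) as [eta [Heta H]].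
  exists eta; split; [exact Heta|]; intros x Hx Hfx.
  apply (H (canonical_embedding x)); [|exact Hfx].
  rewrite <- Hx; apply norm_canonical_embedding.
Qed.
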